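(* There exists an integer $N$ such that for all integers $s > N$ $$\lambda(G(4s,2s,s)) = |E_s(2)| = \frac{4s-2}{s^2}\binom{2s-2}{s-1}^2 = \frac{1}{4s-2}E_s(0),$$ and moreover this quantity is $O\left(\frac{d(G(4s,2s,s))}{s}\right)$ as $s\to\infty$.
   Context: For integers $n,r,s$, the Johnson graph $G(n,r,s)$ has as vertices all vectors $v\in\{0,1\}^n$ with exactly $r$ ones; two vertices are joined by an edge if and only if their inner product equals $s$. It is regular; $d(G)$ denotes the vertex degree of a regular graph $G$, so $d(G(n,r,s))=\binom{r}{s}\binom{n-r}{r-s}$. For a $d$-regular graph $G$ whose adjacency matrix has eigenvalues (with multiplicity) $\lambda_1\ge\lambda_2\ge\dots\ge\lambda_m$, where $m$ is the number of vertices, $\lambda(G):=\max\{\lambda_2,-\lambda_m\}=\max\{|\lambda_2|,\dots,|\lambda_m|\}$. For $G(4s,2s,s)$ put $E_s(i)=\sum_{j=0}^{s}(-1)^j\binom{i}{j}\binom{2s-i}{s-j}^2$ for $0\le i\le 2s$, where a binomial coefficient $\binom{a}{b}$ with $b<0$ or $b>a$ equals $0$. *)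

(* Defs.v *)
From mathcomp Require Import all_boot all_order all_algebra.
From mathcomp Require Import polyrcf.

Set Implicit Arguments.
Unset Strict Implicit.
Unset Printing Implicit Defensive.

Import Order.TTheory GRing.Theory Num.Theory.

Local Open Scope ring_scope.

Definition johnson_vertex (n r : nat) : finType :=
  {v : {ffun 'I_n -> bool} | #|[set i | v i]| == r}.

Definition inner_product n (v w : {ffun 'I_n -> bool}) : nat :=
  (\sum_(i < n) v i * w i)%N.

(* No edge joins a vertex to itself when s != r: the inner product of a vertex
   with itself is r. *)
Definition johnson (n r s : nat) : rel (johnson_vertex n r) :=
  [rel v w | inner_product (sval v) (sval w) == s].

(* All vertices have the same degree in a regular graph, so that the maximum is
   this common value. *)
Definition regular_degree (V : finType) (e : rel V) : nat :=
  (\max_(v : V) #|[set w | e v w]|)%N.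

Definition adjacency_matrix (R : nzRingType) (V : finType) (e : rel V) :
    'M[R]_#|V| :=
  \matrix_(i, j) (e (enum_val i) (enum_val j))%:R.

(* The real eigenvalues in nonincreasing order, repeated according to their
   multiplicity in the characteristic polynomial. *)
Definition eigenvalues (R : rcfType) (m : nat) (A : 'M[R]_m) : seq R :=
  let p := char_poly A in
  sort (fun x y => y <= x) (flatten [seq nseq (mup x p) x | x <- rootsR p]).

(* Indices start at 0: lambda_2 is the entry of index 1. *)
Definition graph_lambda (R : rcfType) (V : finType) (e : rel V) : R :=
  let l := eigenvalues (adjacency_matrix R e) in
  Num.max l`_1 (- last 0 l).

(* The natural subtractions are not truncated for j <= s and i <= 2 * s. *)
Definition E (s i : nat) : int :=
  \sum_(j < s.+1) (-1) ^+ j * ('C(i, j) * 'C(2 * s - i, s - j) ^ 2)%:Z.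

(* Main.v *)
(* For a set I of points let chi_I be the indicator of the vertices that contain
   I. Counting the neighbours of a vertex that contain I shows that the adjacency
   matrix A maps chi_I to a combination of the chi_J with J included in I, in
   which chi_I itself has the coefficient mu(|I|), a finite difference of order
   |I|. If w is an eigenvector and I is minimal with w chi_I <> 0, then the
   eigenvalue of w is mu(|I|); hence every eigenvalue is some mu(i) with
   i <= 2s, and eigenvectors orthogonal to the constants have i > 0.
   The alternating sum mu(i) vanishes for odd i, and for i = 2k it is Dixon's
   well-poised sum; a Wilf-Zeilberger certificate gives the recurrence
   (2s - k)(2s - 2k - 1) mu(2k + 2) = - (2k + 1)(s - k) mu(2k).
   So |mu(2k)| first decreases and then increases in k, and for k >= 1 it is at
   most the larger of |mu(2)| = mu(0) / (4s - 2) and |mu(2s)| = C(2s, s). This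
   is |mu(2)|, since mu(0) = C(2s, s)^2 and C(2s, s) >= 4s - 2. *)
Require Import Defs.
From mathcomp Require Import all_boot all_order all_algebra.
From mathcomp Require Import polyrcf.
From mathcomp Require Import zify ring lra.

Set Implicit Arguments.
Unset Strict Implicit.
Unset Printing Implicit Defensive.

Import Order.TTheory GRing.Theory Num.Theory.
Local Open Scope ring_scope.

(** * The numbers mu(i) and their Wilf-Zeilberger recurrence *)

(** For i <= 2s, the finite difference of order [i] at 0 of the function of t that counts the
    neighbours containing a given i-set that meets the vertex in t points. *)
Definition mu (s i : nat) : int :=
  \sum_(t < i.+1)
    (-1) ^+ (i - t) * ('C(i, t) * 'C(2 * s - t, s) * 'C(2 * s - (i - t), s))%:Z.

(* With 1/z! = 0 for z < 0 the rule 1/(z - 1)! = z/z! holds for all integers, so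
   that the boundary terms of the sums need no separate treatment. *)
Definition inv_fact (z : int) : rat := if z is Posz n then (n`!%:R)^-1 else 0.

Lemma inv_factB1 (z : int) : inv_fact (z - 1) = z%:~R * inv_fact z.
Proof.
case: z => [[|n]|n]; first by rewrite mul0r.
  have -> : n.+1%:Z - 1 = n by lia.
  by rewrite /= factS natrM invfM mulrA mulfV ?mul1r // pnatr_eq0.
have -> : Negz n - 1 = Negz n.+1 by lia.
by rewrite mulr0.
Qed.

Lemma bin_inv_fact (a b : nat) :
  'C(a, b)%:R = a`!%:R * inv_fact b * inv_fact (a%:Z - b%:Z).
Proof.
have [le_ba|lt_ab] := leqP b a.
  have -> : (a%:Z - b%:Z) = (a - b)%N by lia.
  by rewrite -(bin_fact le_ba) /= !natrM; field; rewrite !pnatr_eq0 -!lt0n !fact_gt0.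
rewrite bin_small //.
have -> : (a%:Z - b%:Z) = Negz (b - a).-1 by lia.
by rewrite mulr0.
Qed.

Definition dixon_term (s k t : nat) : rat :=
  (-1) ^+ t * ('C(2 * k, t) * 'C(2 * s - t, s) * 'C(2 * s - 2 * k + t, s))%:R.

(* The WZ mate of [dixon_term], indexed by u = t + 1, the position of the term in
   the sum for k + 1. In the symmetric variable l = u - k - 1 the polynomial
   factor is l^2 - l - 2 (2s - 2k - 1)(s - k) + (2s - k)(k + 1). *)
Definition dixon_cert (s k u : nat) : rat :=
  (u%:R ^+ 2 - (2 * k%:R + 3) * u%:R + (k%:R + 1) * (k%:R + 2)
     - 2 * (2 * s%:R - 2 * k%:R - 1) * (s%:R - k%:R)
     + (2 * s%:R - k%:R) * (k%:R + 1))
  * (-1) ^+ u * (2 * k)`!%:R * inv_fact s ^+ 2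
  * (2 * s + 1 - u)`!%:R * (2 * s - 2 * k - 2 + u)`!%:R
  * inv_fact (u%:Z - 1) * inv_fact ((2 * k + 2)%N%:Z - u%:Z)
  * inv_fact ((s + 1)%N%:Z - u%:Z) * inv_fact (s%:Z - (2 * k + 2)%N%:Z + u%:Z).

(** Both sides are polynomial multiples of one common product of factorials and inverse factorials;
    a polynomial identity remains for [ring]. *)
Lemma dixon_certP (s k u : nat) : (k < s)%N -> (u <= 2 * k + 2)%N ->
  2 * (2 * s%:R - k%:R) * (2 * s%:R - 2 * k%:R - 1) * dixon_term s k.+1 u
  + 2 * (2 * k%:R + 1) * (s%:R - k%:R)
    * (if u is t.+1 then dixon_term s k t else 0)
  = (2 * k%:R + 1) * (dixon_cert s k u.+1 - dixon_cert s k u).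
Proof.
move=> lt_ks le_u.
(* Among the factors that depend on u, these are the smallest factorials and the largest inverse
   factorials; the others are linear multiples of them. *)
set n1 := (2 * s - u)%N; set n2 := (2 * s - 2 * k - 2 + u)%N.
set i1 := inv_fact u; set i2 := inv_fact ((2 * k + 2)%N%:Z - u%:Z).
set i3 := inv_fact ((s + 1)%N%:Z - u%:Z).
set i4 := inv_fact (s%:Z - (2 * k + 1)%N%:Z + u%:Z).
have E1 : inv_fact (u%:Z - 1) = u%:R * i1 by rewrite inv_factB1.
have E2 : inv_fact ((2 * k + 1)%N%:Z - u%:Z) = (2 * k%:R + 2 - u%:R) * i2.
  have -> : (2 * k + 1)%N%:Z - u%:Z = (2 * k + 2)%N%:Z - u%:Z - 1 by lia.
  by rewrite inv_factB1 -/i2; congr (_ * _); rewrite rmorphB /= -!pmulrn natrD natrM.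
have E3 : inv_fact (s%:Z - u%:Z) = (s%:R + 1 - u%:R) * i3.
  have -> : s%:Z - u%:Z = (s + 1)%N%:Z - u%:Z - 1 by lia.
  by rewrite inv_factB1 -/i3; congr (_ * _); rewrite rmorphB /= -!pmulrn natrD.
have E4 : inv_fact (s%:Z - (2 * k + 2)%N%:Z + u%:Z) =
    (s%:R - 2 * k%:R - 1 + u%:R) * i4.
  have -> : s%:Z - (2 * k + 2)%N%:Z + u%:Z = s%:Z - (2 * k + 1)%N%:Z + u%:Z - 1 by lia.
  rewrite inv_factB1 -/i4; congr (_ * _).
  by rewrite rmorphD rmorphB /= -!pmulrn natrD natrM; ring.
have F1 : (2 * s + 1 - u)`!%:R = (2 * s%:R + 1 - u%:R) * n1`!%:R :> rat.
  have -> : (2 * s + 1 - u = n1.+1)%N by rewrite /n1; lia.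
  rewrite factS natrM; congr (_ * _).
  have -> : (n1.+1 = 2 * s + 1 - u)%N by rewrite /n1; lia.
  by rewrite natrB; [rewrite natrD natrM; ring | lia].
have F2 : (2 * s - 2 * k - 2 + u.+1)`!%:R =
    (2 * s%:R - 2 * k%:R - 1 + u%:R) * n2`!%:R :> rat.
  rewrite addnS factS natrM; congr (_ * _).
  by rewrite -addn1 !natrD !natrB ?natrM; [ring | lia | lia].
have T1 : dixon_term s k.+1 u = (-1) ^+ u * ((2 * k%:R + 2) * (2 * k%:R + 1)
    * (2 * k)`!%:R * i1 * i2 * (n1`!%:R * inv_fact s * ((s%:R + 1 - u%:R) * i3))
    * (n2`!%:R * inv_fact s * ((s%:R - 2 * k%:R - 1 + u%:R) * i4))).
  rewrite /dixon_term; congr (_ * _); rewrite !natrM; congr (_ * _ * _).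
  - rewrite bin_inv_fact; congr (_ * _ * _).
      have -> : (2 * k.+1 = (2 * k).+2)%N by lia.
      have e1 : (2 * k).+1%:R = 2 * k%:R + 1 :> rat by rewrite -natr1 natrM.
      have e2 : (2 * k).+2%:R = 2 * k%:R + 2 :> rat by rewrite -natr1 e1; ring.
      by rewrite !factS !natrM e1 e2; ring.
    by rewrite /i2; congr inv_fact; lia.
  - by rewrite bin_inv_fact -/n1 -E3; congr (_ * _ * inv_fact _); rewrite /n1; lia.
  - have -> : (2 * s - 2 * k.+1 + u = n2)%N by rewrite /n2; lia.
    by rewrite bin_inv_fact -E4; congr (_ * _ * inv_fact _); rewrite /n2; lia.
have T0 : (if u is t.+1 then dixon_term s k t else 0) = - (-1) ^+ u *
    ((2 * k)`!%:R * (u%:R * i1) * ((2 * k%:R + 2 - u%:R) * i2)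
     * ((2 * s%:R + 1 - u%:R) * n1`!%:R * inv_fact s * i3)
     * ((2 * s%:R - 2 * k%:R - 1 + u%:R) * n2`!%:R * inv_fact s * i4)).
  case: u @i1 @i2 @i3 @i4 @n1 @n2 le_u E1 E2 E3 E4 F1 F2 T1
    => [|t] i1 i2 i3 i4 n1 n2 le_u E1 E2 E3 E4 F1 F2 T1.
    by rewrite !(mul0r, mulr0).
  rewrite /dixon_term exprS mulN1r opprK; congr (_ * _).
  rewrite !natrM; congr (_ * _ * _).
  - rewrite bin_inv_fact -E1 -E2.
    by congr (_ * inv_fact _ * inv_fact _); lia.
  - rewrite bin_inv_fact -F1; congr (_ `!%:R * _ * inv_fact _); lia.
  - rewrite bin_inv_fact -F2; congr (_ `!%:R * _ * inv_fact _); lia.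
rewrite T0 T1 /dixon_cert F1 F2 E1 -/i2 -/i3 -/n2 E4.
have -> : u.+1%:Z - 1 = u by lia.
have -> : (2 * k + 2)%N%:Z - u.+1%:Z = (2 * k + 1)%N%:Z - u%:Z by lia.
have -> : (s + 1)%N%:Z - u.+1%:Z = s%:Z - u%:Z by lia.
have -> : s%:Z - (2 * k + 2)%N%:Z + u.+1%:Z = s%:Z - (2 * k + 1)%N%:Z + u%:Z by lia.
have -> : (2 * s + 1 - u.+1 = n1)%N by rewrite /n1; lia.
rewrite E2 E3 -/i1 -/i4 [(-1) ^+ u.+1]exprS -[u.+1]addn1 natrD.
ring.
Qed.

Lemma mu_dixon (s k : nat) : (k <= s)%N ->
  (mu s (2 * k))%:~R = \sum_(t < (2 * k).+1) dixon_term s k t.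
Proof.
move=> le_ks; rewrite /mu rmorph_sum /=; apply: eq_bigr => t _.
have le_t : (t <= 2 * k)%N by rewrite -ltnS.
rewrite intrM intr_sign -pmulrn /dixon_term; congr (_ * _).
  by rewrite -[LHS]signr_odd oddB // oddM /= signr_odd.
by congr (_ * 'C(_, _))%:R; lia.
Qed.

(** The sum of [dixon_certP] over u <= 2k + 2 telescopes, and the certificate vanishes at u = 0 and
    u = 2k + 3 through a factor 1/(-1)!. *)
Lemma mu_rec (s k : nat) : (k < s)%N ->
  (2 * s%:R - k%:R) * (2 * s%:R - 2 * k%:R - 1) * (mu s (2 * k.+1))%:~R =
  - ((2 * k%:R + 1) * (s%:R - k%:R) * (mu s (2 * k))%:~R) :> rat.
Proof.
move=> lt_ks; rewrite !mu_dixon ?(ltnW lt_ks) //.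
pose shifted u : rat := if u is t.+1 then dixon_term s k t else 0.
have shiftedE : \sum_(u < (2 * k.+1).+1) shifted u =
    \sum_(t < (2 * k).+1) dixon_term s k t.
  have -> : ((2 * k.+1) = (2 * k).+2)%N by lia.
  (* The extra last term is zero since C(2k, 2k + 1) = 0. *)
  rewrite big_ord_recl /= add0r big_ord_recr /= [X in _ + X](_ : _ = 0) ?addr0 //.
  by rewrite /dixon_term /= /bump /= bin_small ?mul0n ?mulr0 //; lia.
have zero0 : dixon_cert s k 0 = 0 by rewrite /dixon_cert !(mulr0, mul0r).
have zero1 : dixon_cert s k (2 * k.+1).+1 = 0.
  rewrite /dixon_cert; have -> : (2 * k + 2)%N%:Z - (2 * k.+1).+1%:Z = Negz 0 by lia.
  by rewrite !(mulr0, mul0r).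
have : \sum_(u < (2 * k.+1).+1)
    (2 * (2 * s%:R - k%:R) * (2 * s%:R - 2 * k%:R - 1) * dixon_term s k.+1 u
     + 2 * (2 * k%:R + 1) * (s%:R - k%:R) * shifted u) = 0.
  transitivity (\sum_(u < (2 * k.+1).+1)
      (2 * k%:R + 1) * (dixon_cert s k u.+1 - dixon_cert s k u)).
    apply: eq_bigr => u _; rewrite dixon_certP //.
    by have := ltn_ord u; lia.
  rewrite -mulr_sumr -(big_mkord xpredT (fun u => dixon_cert s k u.+1 - dixon_cert s k u)).
  by rewrite telescope_sumr // zero0 zero1 subrr mulr0.
rewrite big_split /= -!mulr_sumr shiftedE => sum0.
by apply/eqP; rewrite -subr_eq0 opprK; apply/eqP; lra.
Qed.

(** * Special values of mu and the bound by |mu(2)| *)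

(** The reflection t -> i - t exchanges the last two binomials and, for odd [i], reverses the
    sign. *)
Lemma mu_odd (s i : nat) : odd i -> (i <= 2 * s)%N -> mu s i = 0.
Proof.
move=> odd_i le_i.
suff : mu s i = - mu s i by lia.
rewrite {1}/mu (reindex_inj rev_ord_inj) /= -sumrN; apply: eq_bigr => t _.
have le_t : (t <= i)%N by rewrite -ltnS.
rewrite subSS subKn // -mulNr bin_sub //; congr (_ * _%:Z); last first.
  by rewrite mulnAC.
by rewrite -[in RHS]signr_odd oddB // odd_i addTb signrN signr_odd opprK.
Qed.

Lemma mu0 (s : nat) : mu s 0 = ('C(2 * s, s) ^ 2)%:Z.
Proof. by rewrite /mu big_ord1 /= mul1r subn0 bin0 mul1n mulnn. Qed.

(** Only t = s survives: C(2s - t, s) = 0 for t > s, and C(t, s) = 0 for t < s. *)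
Lemma mu_last (s : nat) : `|mu s (2 * s)| = 'C(2 * s, s).
Proof.
rewrite /mu.
have lt_s : (s < (2 * s).+1)%N by lia.
rewrite (bigD1 (Ordinal lt_s)) //= big1 ?addr0.
  have e : (2 * s - s = s)%N by lia.
  by rewrite !e binn !muln1 normrM normrX normrN1 expr1n mul1r ger0_norm.
move=> t /eqP ne_t; have ne : t <> s :> nat by move=> e; apply: ne_t; apply: val_inj.
have le_t := ltn_ord t.
have [lt_ts|le_st] := ltnP t s.
  by rewrite ['C(2 * s - (2 * s - t), s)]bin_small ?muln0 ?mulr0 //; lia.
by rewrite ['C(2 * s - t, s)]bin_small ?muln0 ?mul0n ?mulr0 //; lia.
Qed.

(** The recurrence at k = 0 reads 2s (2s - 1) mu(2) = - s mu(0), and mu(0) >= 0 fixes the sign. *)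
Lemma mu2 (R : nzRingType) (s : nat) : (0 < s)%N ->
  (4 * s%:R - 2) * `|mu s 2|%:~R = (mu s 0)%:~R :> R.
Proof.
move=> s_gt0.
suff <- : (4 * s%:Z - 2) * `|mu s 2| = mu s 0 by rewrite intrM rmorphB /= intrM -pmulrn.
apply: (@intr_inj rat); rewrite intrM rmorphB /= intrM -pmulrn.
have := mu_rec s_gt0; rewrite muln0 !mulr0 !subr0 add0r mul1r.
have s_ge1 : 1 <= s%:R :> rat by rewrite ler1n.
have m0 : 0 <= (mu s 0)%:~R :> rat by rewrite ler0z mu0.
rewrite muln1 intr_norm => rec; rewrite ler0_norm.
  by apply: (mulfI (_ : s%:R != 0)); [lra | lra].
by rewrite -(pmulr_rle0 _ (_ : 0 < 2 * s%:R * (2 * s%:R - 1))) ?rec; nra.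
Qed.

Lemma mu2_le0 (s : nat) : (0 < s)%N -> mu s 2 <= 0.
Proof.
move=> s_gt0; have := mu_rec s_gt0; rewrite muln0 !mulr0 !subr0 add0r mul1r.
have s_ge1 : 1 <= s%:R :> rat by rewrite ler1n.
have m0 : 0 <= (mu s 0)%:~R :> rat by rewrite ler0z mu0.
rewrite muln1 -(ler_int rat) => rec.
by rewrite -(pmulr_rle0 _ (_ : 0 < 2 * s%:R * (2 * s%:R - 1))) ?rec; nra.
Qed.

Lemma central_bin_ge (s : nat) : (1 < s)%N -> (4 * s <= 'C(2 * s, s) + 2)%N.
Proof.
elim: s => [|[|[|s]] IHs] // _; have {}IHs := IHs isT.
have -> : (2 * s.+3 = (2 * s.+2).+2)%N by lia.
by rewrite [X in (_ <= X + _)%N]binS !['C((2 * s.+2).+1, _)]binS; lia.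
Qed.

Lemma norm_mu_rec (s k : nat) : (k < s)%N ->
  (2 * s%:R - k%:R) * (2 * s%:R - 2 * k%:R - 1) * `|(mu s (2 * k.+1))%:~R| =
  (2 * k%:R + 1) * (s%:R - k%:R) * `|(mu s (2 * k))%:~R| :> rat.
Proof.
move=> lt_ks; have le_ks : k%:R + 1 <= s%:R :> rat by rewrite natr1 ler_nat.
have k_ge0 : 0 <= k%:R :> rat by [].
have := congr1 Num.norm (mu_rec lt_ks).
rewrite normrN 2!normrM [in RHS]normrM [in RHS]normrM.
rewrite (@ger0_norm _ (2 * s%:R - k%:R)); last by lra.
rewrite (@ger0_norm _ (2 * s%:R - 2 * k%:R - 1)); last by lra.
rewrite (@ger0_norm _ (2 * k%:R + 1)); last by lra.
by rewrite (@ger0_norm _ (s%:R - k%:R)) //; lra.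
Qed.

(* With t = s - k, the ratio |mu(2k + 2)| / |mu(2k)| is at most 1 if and only if
   k + 3t <= 4t^2. *)
Definition mu_descent (s k : nat) : bool := (s + 2 * (s - k) <= 4 * (s - k) ^ 2)%N.

Lemma norm_mu_leS (s k : nat) : (k < s)%N ->
  if mu_descent s k then `|mu s (2 * k.+1)| <= `|mu s (2 * k)|
  else `|mu s (2 * k)| <= `|mu s (2 * k.+1)|.
Proof.
move=> lt_ks; rewrite -!(ler_int rat) !intr_norm.
have := norm_mu_rec lt_ks.
set a := `|_|; set b := `|_|; move: (normr_ge0 _ : 0 <= a) (normr_ge0 _ : 0 <= b).
have [t [t_gt0 ->]] : exists t, (0 < t)%N /\ s = (t + k)%N.
  by exists (s - k)%N; lia.
have t_ge1 : 1 <= t%:R :> rat by rewrite ler1n.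
have k_ge0 : 0 <= k%:R :> rat by [].
move=> {lt_ks} a_ge0 b_ge0; rewrite /mu_descent addnK natrD => rec.
have c_gt0 : 0 < (2 * (t%:R + k%:R) - k%:R) * (2 * (t%:R + k%:R) - 2 * k%:R - 1) :> rat.
  by apply: mulr_gt0; lra.
case: leqP => [|/ltnW]; rewrite -(ler_nat rat) !natrD !natrM ?natrX ?natrD => cond;
  rewrite -(ler_pM2l c_gt0) rec.
  by apply: ler_wpM2r => //; nra.
by apply: ler_wpM2r => //; nra.
Qed.

(** Since 4t^2 - 2t is nondecreasing in t = s - k, the descents form an initial segment of the
    indices. *)
Lemma mu_descent_leq (s k k' : nat) : (k <= k')%N ->
  mu_descent s k' -> mu_descent s k.
Proof. rewrite /mu_descent; nia. Qed.

Lemma norm_mu_even_le (s k : nat) : (1 < s)%N -> (0 < k <= s)%N ->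
  `|mu s (2 * k)| <= `|mu s 2|.
Proof.
move=> s_gt1 /andP[k_gt0 le_ks].
(* The steps from 1 to j all descend; at j = 0 both sides coincide. *)
have down j : (j.+1 <= s)%N -> (j == 0) || mu_descent s j ->
    `|mu s (2 * j.+1)| <= `|mu s 2|.
  elim: j => [|j IHj] //= lt_js desc.
  have := norm_mu_leS lt_js; rewrite desc => /le_trans; apply.
  by apply: IHj; [lia | rewrite (@mu_descent_leq _ _ j.+1) ?orbT].
(* From an ascent at m on, every step ascends up to the last index. *)
have up j m : (m + j = s)%N -> ~~ mu_descent s m ->
    `|mu s (2 * m)| <= `|mu s (2 * s)|.
  elim: j m => [|j IHj] m; first by rewrite addn0 => ->.
  move=> mj asc; have := @norm_mu_leS s m; rewrite (negPf asc) => /(_ _)/le_trans; apply.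
    by lia.
  by apply: IHj; [lia | apply: contra asc; apply: mu_descent_leq].
case: k k_gt0 le_ks => // k _ lt_ks.
have [desc|asc] := boolP (mu_descent s k); first by rewrite down ?desc ?orbT.
have [k0|k_gt0] := posnP k; first by rewrite k0.
apply: (@le_trans _ _ `|mu s (2 * s)|).
  apply: (up (s - k.+1)%N); first by lia.
  by apply: contra asc; apply: mu_descent_leq.
(* With C = C(2s, s), the bound C >= 4s - 2 gives C <= C^2 / (4s - 2) = |mu(2)|. *)
rewrite mu_last -(ler_int rat).
have s_ge2 : 2 <= s%:R :> rat by rewrite ler_nat.
have := mu2 rat (ltnW s_gt1); have := central_bin_ge s_gt1.
rewrite mu0; set x : rat := `|mu s 2|%:~R; rewrite -!pmulrn natrX -(ler_nat rat) natrD natrM.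
set C : rat := 'C(_, _)%:R => leC eqx.
have C_ge0 : 0 <= C by [].
by rewrite -(ler_pM2l (_ : 0 < 4 * s%:R - 2)) ?eqx; nra.
Qed.

Lemma norm_mu_le (s i : nat) : (1 < s)%N -> (0 < i <= 2 * s)%N ->
  `|mu s i| <= `|mu s 2|.
Proof.
move=> s_gt1 /andP[i_gt0 le_i].
have [odd_i|even_i] := boolP (odd i); first by rewrite mu_odd ?normr0.
have -> : i = (2 * i./2)%N by lia.
by apply: norm_mu_even_le; lia.
Qed.

(** Combines [mu2] with s C(2s, s) = 2 (2s - 1) C(2s - 2, s - 1). *)
Lemma mu2_formula (R : realFieldType) (s : nat) : (0 < s)%N ->
  `|mu s 2|%:~R =
    (4 * s%:R - 2) / s%:R ^+ 2 * 'C(2 * s - 2, s - 1)%:R ^+ 2 :> R.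
Proof.
case: s => // m _; have m_ge0 : 0 <= m%:R :> R by [].
have := @mu2 R m.+1 isT; rewrite mu0; set x : R := _%:~R; rewrite -pmulrn natrX.
have -> : (2 * m.+1 - 2 = 2 * m)%N by lia.
have -> : (m.+1 - 1 = m)%N by lia.
have binE : m.+1%:R * 'C(2 * m.+1, m.+1)%:R = 2 * (2 * m%:R + 1) * 'C(2 * m, m)%:R :> R.
  have e1 := mul_bin_diag (2 * m).+2 m; have e2 := mul_bin_down (2 * m).+1 m.
  move: e1 e2; rewrite /= => e1 e2.
  have -> : (2 * m.+1 = (2 * m).+2)%N by lia.
  have : (m.+1 * 'C((2 * m).+2, m.+1) = 2 * (2 * m + 1) * 'C(2 * m, m))%N.
    rewrite -e1; have e3 : ((2 * m).+1 - m = m.+1)%N by lia.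
    by move: e2; rewrite e3; nia.
  by move/(congr1 (fun n => n%:R : R)); rewrite !natrM natrD natrM.
have S_neq0 : m.+1%:R != 0 :> R by rewrite pnatr_eq0.
move: binE; rewrite [in X in X -> _]mulrC => /(canRL (mulfK S_neq0)) ->.
rewrite -natr1 in S_neq0 *; set b : R := 'C(_, _)%:R => eqx.
have D_neq0 : 4 * (m%:R + 1) - 2 != 0 :> R by apply/eqP; lra.
apply: (mulfI D_neq0); rewrite eqx.
by field.
Qed.

(** * Comparison with E *)

Lemma E0_mu (s : nat) : E s 0 = mu s 0.
Proof.
rewrite mu0 /E big_ord_recl big1 /= ?addr0 => [|j _].
  by rewrite bin0 mul1n mul1r !subn0.
by rewrite bin0n mul0n mulr0.
Qed.

(** For s = m + 1 both sums reduce to 2 (C(2m, m + 1)^2 - C(2m, m)^2). *)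
Lemma E2_mu (s : nat) : (0 < s)%N -> E s 2 = mu s 2.
Proof.
case: s => // m _.
have e : (2 * m.+1 = (2 * m).+2)%N by lia.
have sym : 'C((2 * m).+1, m) = 'C((2 * m).+1, m.+1).
  by rewrite -bin_sub; [congr 'C(_, _); lia | lia].
have -> : mu m.+1 2 =
    2 * ('C(2 * m, m.+1)%:Z ^+ 2 - 'C(2 * m, m)%:Z ^+ 2).
  rewrite /mu !big_ord_recl big_ord0 /= /bump /= e !subn0 !subSS !subn0 bin0 binn.
  by rewrite bin1 binS sym binS !PoszM !PoszD; ring.
(* For s = 1 the sum for [E] has no term j = 2, hence the case split. *)
rewrite /E e !subSS !subn0; case: m e sym => [|m] e sym.
  by rewrite !big_ord_recl big_ord0 /= /bump.
rewrite 3!big_ord_recl big1 /= => [|j _]; last first.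
  by rewrite /bump /= bin_small ?mul0n ?mulr0.
rewrite /bump /= !subSS !subn0 bin0 binn bin1.
have -> : 'C(2 * m.+1, m) = 'C(2 * m.+1, m.+2).
  by rewrite -bin_sub; [congr 'C(_, _); lia | lia].
by rewrite -!mulnn !PoszM; ring.
Qed.

(** * Finite differences and Newton's formula *)

(** The forward difference of order [j] at 0. *)
Definition fdiff (R : comNzRingType) (g : nat -> R) (j : nat) : R :=
  \sum_(u < j.+1) (-1) ^+ (j - u) * 'C(j, u)%:R * g u.

Lemma fdiffS (R : comNzRingType) (g : nat -> R) (j : nat) :
  fdiff g j.+1 = fdiff (fun t => g t.+1 - g t) j.
Proof.
rewrite /fdiff; under [RHS]eq_bigr do rewrite mulrBr.
rewrite sumrB big_ord_recl /=.
under eq_bigr do rewrite /bump /= subSS binS natrD mulrDr mulrDl.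
rewrite big_split /= addrA addrC; congr (_ + _).
transitivity (\sum_(u < j.+2) (-1) ^+ (j.+1 - u) * 'C(j, u)%:R * g u).
  by rewrite [RHS]big_ord_recl /= !bin0.
rewrite big_ord_recr /= bin_small // mulr0 mul0r addr0 -sumrN.
by apply: eq_bigr => u _; rewrite subSn ?exprS ?mulN1r ?mulNr // -ltnS.
Qed.

(** By Pascal's rule the series at t + 1 splits into the series at t of [g] and of its first
    difference. *)
Lemma newton_series (R : comNzRingType) (g : nat -> R) (t : nat) :
  \sum_(j < t.+1) 'C(t, j)%:R * fdiff g j = g t.
Proof.
elim: t g => [|t IHt] g.
  by rewrite !big_ord1 /= /fdiff big_ord1 /= expr0 !mul1r.
rewrite big_ord_recl /=.
under eq_bigr do rewrite /bump /= binS natrD mulrDl.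
rewrite big_split /= addrA.
have -> : 'C(t.+1, 0)%:R * fdiff g 0
    + \sum_(i < t.+1) 'C(t, 1 + i)%:R * fdiff g (1 + i) =
    \sum_(j < t.+2) 'C(t, j)%:R * fdiff g j.
  by rewrite [RHS]big_ord_recl /= !bin0.
rewrite big_ord_recr /= bin_small // mul0r addr0 IHt.
under eq_bigr do rewrite add1n fdiffS.
by rewrite (IHt (fun t => g t.+1 - g t)) addrC subrK.
Qed.

(** Newton's formula with the subsets grouped by size; it expands a function of an intersection size
    in indicators of subsets. *)
Lemma sum_subset_fdiff (R : comNzRingType) (T : finType) (g : nat -> R)
    (X : {set T}) :
  \sum_(J : {set T} | J \subset X) fdiff g #|J| = g #|X|.
Proof.
rewrite -newton_series.
rewrite (partition_big (fun J : {set T} => inord #|J| : 'I_#|X|.+1) xpredT) //=.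
apply: eq_bigr => j _; rewrite -cards_draws -[#|[set _ | _]|]sum1_card natr_sum mulr_suml.
apply: eq_big => [J|J /andP[]].
  rewrite inE; case: (boolP (J \subset X)) => //= sJX.
  by rewrite -val_eqE /= inordK // ltnS subset_leq_card.
move=> sJX; rewrite -val_eqE /= inordK ?ltnS ?subset_leq_card // => /eqP ->.
by rewrite mul1r.
Qed.

(** * Neighbour counts and the action of the adjacency matrix *)

Lemma card_split_draws (T : finType) (A B : {set T}) (a b : nat) :
  #|[set Z : {set T} | [&& Z \subset B, #|Z :&: A| == a & #|Z :\: A| == b]]| =
  ('C(#|B :&: A|, a) * 'C(#|B :\: A|, b))%N.
Proof.
rewrite -!cards_draws -cardsX.
set S := setX _ _; pose f (u : {set T} * {set T}) := u.1 :|: u.2.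
have capA u : u \in S -> f u :&: A = u.1.
  case: u => P Q; rewrite in_setX !inE /f /=.
  move=> /andP[/andP[/subsetP sP _] /andP[/subsetP sQ _]].
  apply/setP => x; rewrite !inE; have /implyP := sP x; have /implyP := sQ x; rewrite !inE.
  by case: (x \in P) (x \in Q) (x \in A) (x \in B) => [] [] [] [].
have capC u : u \in S -> f u :\: A = u.2.
  case: u => P Q; rewrite in_setX !inE /f /=.
  move=> /andP[/andP[/subsetP sP _] /andP[/subsetP sQ _]].
  apply/setP => x; rewrite !inE; have /implyP := sP x; have /implyP := sQ x; rewrite !inE.
  by case: (x \in P) (x \in Q) (x \in A) (x \in B) => [] [] [] [].
rewrite -(@card_in_imset _ _ f) => [|u v Su Sv eq_uv]; last first.
  by rewrite [u]surjective_pairing [v]surjective_pairing -!capA // -!capC // eq_uv.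
apply: eq_card => Z; rewrite inE; apply/and3P/imsetP => [[sZB cA cC]|[u Su ->]].
  exists (Z :&: A, Z :\: A); last by rewrite /f /= setID.
  by rewrite in_setX !inE cA cC !andbT setSI ?setSD.
rewrite capA // capC //; case: u Su => P Q.
rewrite in_setX !inE /= => /andP[/andP[sP ->] /andP[sQ ->]]; split=> //.
by rewrite /f subUset /= (subset_trans sP) ?subsetIl // (subset_trans sQ) ?subsetDl.
Qed.

Definition vertex_set (n r : nat) (x : johnson_vertex n r) : {set 'I_n} :=
  [set i | sval x i].

Lemma card_vertex_set (n r : nat) (x : johnson_vertex n r) : #|vertex_set x| = r.
Proof. exact/eqP/(svalP x). Qed.

Lemma vertex_set_inj (n r : nat) : injective (@vertex_set n r).
Proof.
move=> x y /setP eq_xy; apply/val_inj/ffunP => i.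
by have := eq_xy i; rewrite !inE.
Qed.

Lemma vertex_set_onto (n r : nat) (X : {set 'I_n}) :
  #|X| = r -> exists x : johnson_vertex n r, vertex_set x = X.
Proof.
move=> cardX; have eqX : [set i | [ffun i => i \in X] i] = X.
  by apply/setP => i; rewrite inE ffunE.
have PX : #|[set i | [ffun i => i \in X] i]| == r by rewrite eqX cardX.
by exists (exist _ [ffun i => i \in X] PX).
Qed.

Lemma johnsonE (n r s : nat) (x y : johnson_vertex n r) :
  @johnson n r s x y = (#|vertex_set x :&: vertex_set y| == s).
Proof.
rewrite /johnson /= /inner_product; congr (_ == s).
rewrite -sum1_card [RHS]big_mkcond /=.
by apply: eq_bigr => i _; rewrite !inE; case: (sval x i) (sval y i) => [] [].
Qed.

(** Complements are counted: the complement of a neighbour containing [I] avoids [I] and has s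
    points inside and s points outside the set of [x]. *)
Lemma card_johnson_nbhd (s : nat) (x : johnson_vertex (4 * s) (2 * s))
    (I : {set 'I_(4 * s)}) :
  let t := #|I :&: vertex_set x| in
  #|[set y | @johnson (4 * s) (2 * s) s x y & I \subset vertex_set y]| =
  ('C(2 * s - t, s) * 'C(2 * s - (#|I| - t), s))%N.
Proof.
move=> t; set X := vertex_set x; have cardX : #|X| = (2 * s)%N by apply: card_vertex_set.
have cardCX : #|~: X| = (2 * s)%N by have := cardsC X; rewrite card_ord cardX; lia.
have -> : (2 * s - t)%N = #|~: I :&: X|.
  by rewrite -cardX -(cardsID I X) setIC /t -/X addKn setDE setIC.
have -> : (2 * s - (#|I| - t))%N = #|~: I :\: X|.
  rewrite -(cardsID X I) /t -/X addKn -cardCX -(cardsID I (~: X)).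
  by rewrite setIC -setDE addKn !setDE setIC.
rewrite -card_split_draws -(card_imset _ (@vertex_set_inj _ _))
  -(card_imset _ (can_inj (@setCK _))).
apply: eq_card => Z; rewrite inE; apply/imsetP/and3P => [[Y]|[sZ /eqP cZ /eqP cZC]].
  case/imsetP => y; rewrite inE johnsonE -/X => /andP[/eqP cY sIY] -> ->.
  have cy := card_vertex_set y; move: cY sIY cy; set W := vertex_set y => cY sIY cy.
  rewrite setCS sIY; split=> //; apply/eqP.
    by have := cardsID W X; rewrite cY cardX setDE setIC; lia.
  have := cardsC (X :|: W); have := cardsUI X W.
  by rewrite setCU cY cardX cy card_ord setDE setIC; lia.
exists (~: Z); last by rewrite setCK.
have cardZ : #|~: Z| = (2 * s)%N.
  have := cardsC Z; have := cardsID X Z; rewrite card_ord cZ cZC; lia.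
have [y eqy] := vertex_set_onto cardZ.
apply/imsetP; exists y => //; rewrite inE johnsonE -/X eqy -[I \subset _]setCS setCK.
rewrite sZ andbT -setDE; apply/eqP.
by have := cardsID Z X; rewrite setIC cZ cardX; lia.
Qed.

Definition subset_col (R : comNzRingType) (n r : nat) (I : {set 'I_n}) :
    'cV[R]_#|johnson_vertex n r| :=
  \col_j (I \subset vertex_set (enum_val j))%:R.

Lemma fdiff_mu (R : comNzRingType) (s i : nat) :
  fdiff (fun t => ('C(2 * s - t, s) * 'C(2 * s - (i - t), s))%:R) i =
  (mu s i)%:~R :> R.
Proof.
rewrite /mu rmorph_sum /=; apply: eq_bigr => t _.
  by rewrite intrM intr_sign -pmulrn -mulrA -natrM mulnA.
Qed.

(** The entry at x counts the neighbours containing [I], a function of |I :&: x|, which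
    [sum_subset_fdiff] expands over the J included in both [I] and x. *)
Lemma adjacency_subset_col (R : comNzRingType) (s : nat) (I : {set 'I_(4 * s)}) :
  adjacency_matrix R (@johnson (4 * s) (2 * s) s) *m subset_col R (2 * s) I =
  \sum_(J : {set 'I_(4 * s)} | J \subset I)
    fdiff (fun t => ('C(2 * s - t, s) * 'C(2 * s - (#|I| - t), s))%:R) #|J|
      *: subset_col R (2 * s) J.
Proof.
apply/colP => i; rewrite [RHS]summxE mxE.
set x := enum_val i; set g := fun t : nat => _.
transitivity (g #|I :&: vertex_set x|).
  rewrite /g -card_johnson_nbhd -sum1_card natr_sum [RHS]big_mkcond /=.
  rewrite [RHS](reindex (@enum_val _ predT)); last exact/onW_bij/enum_val_bij.
  apply: eq_big => [j|j _] //=; rewrite !mxE inE -/x.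
  by case: (johnson _ _) (_ \subset _) => [] []; rewrite ?mulr0 ?mulr1.
rewrite -sum_subset_fdiff big_mkcond [RHS]big_mkcond /=.
apply: eq_bigr => J _; rewrite !mxE subsetI -/x.
by case: (J \subset I) (J \subset vertex_set x) => [] []; rewrite ?mulr1 ?mulr0.
Qed.

Lemma mul_adjacency_subset_col (R : comNzRingType) (s : nat)
    (I : {set 'I_(4 * s)}) (w : 'rV[R]_#|johnson_vertex (4 * s) (2 * s)|) :
  (forall J : {set 'I_(4 * s)}, J \proper I -> w *m subset_col R (2 * s) J = 0) ->
  w *m adjacency_matrix R (@johnson (4 * s) (2 * s) s) *m subset_col R (2 * s) I =
  (mu s #|I|)%:~R *: (w *m subset_col R (2 * s) I).
Proof.
move=> w0; rewrite -mulmxA adjacency_subset_col mulmx_sumr (bigD1 I) //= big1.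
  by rewrite addr0 -scalemxAr fdiff_mu.
by move=> J /andP[sJI neJI]; rewrite -scalemxAr w0 ?scaler0 // properEneq neJI.
Qed.

(** All vertex sets have r elements, so none contains another one: the column is a unit vector. *)
Lemma mul_subset_col_vertex (R : comNzRingType) (n r : nat)
    (w : 'rV[R]_#|johnson_vertex n r|) (i : 'I_#|johnson_vertex n r|) :
  (w *m subset_col R r (vertex_set (enum_val i))) 0 0 = w 0 i.
Proof.
rewrite mxE (bigD1 i) //= mxE subxx mulr1 big1 ?addr0 // => j ne_ji.
rewrite mxE (_ : _ \subset _ = false) ?mulr0 //.
apply: contraNF ne_ji => sij; apply/eqP/enum_val_inj/esym/vertex_set_inj/eqP.
by rewrite eqEcard sij !card_vertex_set leqnn.
Qed.

(** * Eigenvalues of the adjacency matrix and their multiplicities *)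

(** The column of [set0] is the all-ones column, so the last clause excludes i = 0 for eigenvectors
    orthogonal to the constants. *)
Lemma eigenvalue_mu (F : fieldType) (s : nat) (a : F)
    (w : 'rV[F]_#|johnson_vertex (4 * s) (2 * s)|) :
  w != 0 -> w *m adjacency_matrix F (@johnson (4 * s) (2 * s) s) = a *: w ->
  exists2 i, (i <= 2 * s)%N &
    a = (mu s i)%:~R /\ (i = 0%N -> w *m subset_col F (2 * s) set0 != 0).
Proof.
move=> w_neq0 eig.
have [i wi] : exists i, w 0 i != 0.
  apply/existsP; apply: contra_neqT w_neq0 => /existsPn w0.
  by apply/rowP => i; rewrite mxE; apply/eqP/negPn.
have WI0 : w *m subset_col F (2 * s) (vertex_set (enum_val i)) != 0.
  by apply: contraNneq wi => e; rewrite -mul_subset_col_vertex e mxE.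
case: (@arg_minnP _ _ (fun I => w *m subset_col F (2 * s) I != 0)
  (fun I : {set _} => #|I|) WI0) => I WI minI.
exists #|I|; first by rewrite -(card_vertex_set (enum_val i)) minI.
split; last by move/cards0_eq => <-.
have := @mul_adjacency_subset_col _ s I w; rewrite eig -scalemxAl => eqI.
apply/eqP; rewrite -subr_eq0; apply: contraNT WI => ne; apply/eqP.
apply: (scalerI ne); rewrite scaler0 scalerBl eqI ?subrr // => J pJI.
apply/eqP; apply: contraTT (proper_card pJI) => WJ.
by rewrite -leqNgt minI.
Qed.

(* A functional [c] that satisfies [w A c = a (w c)] on an [A]-stable set of rows
   is an eigenvector of the transpose of the restriction; Cayley-Hamilton spares
   the construction of this restriction. *)
Lemma root_char_poly_functional (F : fieldType) (n : nat) (A : 'M[F]_n)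
    (c : 'cV[F]_n) (a : F) (P : 'rV[F]_n -> Prop) (w : 'rV[F]_n) :
  (forall v, P v -> P (v *m A)) ->
  (forall v, P v -> v *m A *m c = a *: (v *m c)) ->
  P w -> w *m c != 0 -> root (char_poly A) a.
Proof.
case: n A c P w => [|n] A c P w stable eig Pw wc.
  by rewrite thinmx0 mul0mx eqxx in wc.
have eigp (p : {poly F}) v : P v -> v *m horner_mx A p *m c = p.[a] *: (v *m c).
  elim/poly_ind: p v => [|p b IHp] v Pv.
    by rewrite rmorph0 mulmx0 mul0mx horner0 scale0r.
  rewrite mulrC rmorphD rmorphM /= horner_mx_X horner_mx_C mulmxDr mulmxDl.
  rewrite mulmxA IHp ?eig //; last exact: stable.
  by rewrite mul_mx_scalar -scalemxAl scalerA -scalerDl !hornerE mulrC.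
have := eigp (char_poly A) w Pw; rewrite Cayley_Hamilton mulmx0 mul0mx.
by move/esym/eqP; rewrite scaler_eq0 (negPf wc) orbF.
Qed.

(* In the basis obtained by replacing the first vector by the all-ones vector,
   the matrix is block triangular with the row sum [d] as first block. *)
Lemma mup_row_sum (F : fieldType) (n : nat) (A : 'M[F]_n) (d : F) :
  A *m const_mx 1 = d *: const_mx 1 :> 'cV_n ->
  (forall w : 'rV_n, w *m A = d *: w -> w *m (const_mx 1 : 'cV_n) = 0 -> w = 0) ->
  (mup d (char_poly A) <= 1)%N.
Proof.
case: n A => [|n] A row_sum simple.
  rewrite mupNroot // -eigenvalue_root_char; apply/eigenvalueP => -[v _].
  by rewrite thinmx0 eqxx.
move: A row_sum simple; rewrite -[n.+1]/(1 + n)%N => A.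
rewrite -[A]submxK; set a := ulsubmx A; set b := ursubmx A.
set c := dlsubmx A; set D := drsubmx A.
have one_col m : const_mx 1 = col_mx (const_mx 1) (const_mx 1) :> 'cV[F]_(1 + m).
  by apply/colP => i; rewrite mxE; case: (splitP i) => j ij; rewrite !mxE;
     case: split => k; rewrite mxE.
rewrite one_col mul_block_col scale_col_mx => /eq_col_mx[sum1 sum2] simple.
have one11 : const_mx 1 = 1%:M :> 'M[F]_1.
  by apply/matrixP => i j; rewrite !ord1 !mxE.
rewrite one11 mulmx1 in sum1; rewrite one11 mulmx1 in sum2.
set u := const_mx 1 : 'cV[F]_n.
(* The map induced on the quotient by the all-ones column. *)
pose B := D - u *m b.
have charE : char_poly (block_mx a b c D) = ('X - d%:P) * char_poly B.
  rewrite /char_poly.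
  pose U := map_mx polyC u.
  (* The outer factors are inverse to each other and have determinant 1. *)
  have : block_mx 1%:M 0 (- U) 1%:M *m char_poly_mx (block_mx a b c D)
      *m block_mx 1%:M 0 U 1%:M =
      block_mx ('X - d%:P)%:M (- map_mx polyC b) 0 (char_poly_mx B).
    rewrite /char_poly_mx map_block_mx scalar_mx_block opp_block_mx add_block_mx.
    have S1 := congr1 (map_mx polyC) sum1; have S2 := congr1 (map_mx polyC) sum2.
    rewrite map_mxD map_mxM /= scalemx1 map_scalar_mx /= -/U in S1.
    rewrite map_mxD map_mxM map_mxZ /= -/U in S2.
    rewrite !mulmx_block !mul1mx !mul0mx !mulmx1 !mulmx0 !addr0 !add0r.
    rewrite map_mxB map_mxM -/U !mulmxDl !mulmxDr !(mulNmx, mulmxN) !opprK.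
    rewrite mul_mx_scalar mul_scalar_mx; congr block_mx.
    - by rewrite -addrA -opprD S1 -raddfB.
    - set y := 'X *: U; set z := map_mx polyC D *m U.
      have -> : map_mx polyC c = d%:P *: U - z by rewrite -S2 /z addrK.
      rewrite -[U *m map_mx _ b *m U]mulmxA.
      have -> : map_mx polyC b *m U = d%:P%:M - map_mx polyC a by rewrite -S1 addrC addKr.
      rewrite mulmxBr mul_mx_scalar.
      by apply/matrixP => i j; rewrite !mxE; ring.
    - by apply/matrixP => i j; rewrite !mxE; ring.
  move/(congr1 determinant); rewrite !det_mulmx !det_lblock !det1 !mul1r !mulr1.
  by rewrite det_ublock det_scalar1.
rewrite charE mupMl; first by rewrite -[X in mup _ X]expr1 mup_XsubCX eqxx.
rewrite -eigenvalue_root_char; apply/eigenvalueP => -[v vB v_neq0].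
have vD : v *m D = d *: v + v *m u *m b by rewrite -vB /B mulmxBr mulmxA subrK.
have vc : v *m c = d *: (v *m u) - v *m D *m u.
  by rewrite -mulmxA scalemxAr -sum2 mulmxDr addrK.
(* A left eigenvector of [B] for d lifts to one of the whole matrix; the first entry makes it
   orthogonal to the ones. *)
have /eqP : row_mx (- (v *m u)) v = 0 :> 'rV_(1 + n).
  apply: simple.
    rewrite mul_row_block scale_row_mx vc vD; congr row_mx.
      have -> : a = d%:M - b *m u by rewrite -scalemx1 -sum1 addrK.
      rewrite mulNmx mulmxBr mul_mx_scalar mulmxDl -scalemxAl !mulmxA.
      by apply/matrixP => i j; rewrite !mxE; ring.
    by rewrite mulNmx addrC addrK.
  by rewrite one11 mul_row_col mulmx1 addNr.
by rewrite row_mx_eq0 (negPf v_neq0) andbF.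
Qed.

Lemma subset_setU1_notin (T : finType) (a : T) (J C : {set T}) :
  a \notin J -> (J \subset a |: C) = (J \subset C).
Proof.
move=> aJ; apply/subsetP/subsetP => sJ x Jx; last by rewrite in_setU1 sJ ?orbT.
have := sJ x Jx; rewrite in_setU1 => /predU1P[xa|//].
by rewrite xa (negPf aJ) in Jx.
Qed.

Lemma delta_mul_subset_col (R : comNzRingType) (n r : nat)
    (x : johnson_vertex n r) (I : {set 'I_n}) :
  delta_mx 0 (enum_rank x) *m subset_col R r I =
  (I \subset vertex_set x)%:R%:M :> 'M_1.
Proof. by rewrite -rowE [LHS]mx11_scalar !mxE enum_rankK. Qed.

Lemma four_ordinals (s : nat) : (0 < s)%N ->
  exists p : 'I_4 -> 'I_(4 * s), injective p.
Proof.
move=> s_gt0; have le4 : (4 <= 4 * s)%N by lia.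
by exists (widen_ord le4) => i j /(congr1 val) /= /val_inj.
Qed.

(* The test vector takes the values of [(x_0 - x_1) (x_2 - x_3)] on the sets that
   contain a fixed [B] and two more elements. *)
Lemma root_char_poly_mu2 (F : fieldType) (s : nat) : (0 < s)%N ->
  root (char_poly (adjacency_matrix F (@johnson (4 * s) (2 * s) s)))
    (mu s 2)%:~R.
Proof.
move=> s_gt0; have [p p_inj] := four_ordinals s_gt0.
set A := adjacency_matrix _ _.
pose Q := [set p i | i in 'I_4].
have cardQ : #|~: Q| = (4 * s - 4)%N.
  by apply: (@addnI 4); rewrite -[X in (X + _)%N]card_ord
    -(card_imset _ p_inj) cardsC card_ord; lia.
have [B] : exists B : {set 'I_(4 * s)},
    B \in [set B : {set 'I_(4 * s)} | B \subset ~: Q & #|B| == (2 * s - 2)%N].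
  by apply/set0Pn; rewrite -card_gt0 cards_draws bin_gt0 cardQ; lia.
rewrite inE => /andP[/subsetP sB /eqP cardB].
have pB i : p i \notin B.
  by apply/negP => /sB; rewrite inE imset_f // inE.
have vert i j : i != j ->
    exists x : johnson_vertex (4 * s) (2 * s), vertex_set x = p i |: (p j |: B).
  move=> ne_ij; apply: vertex_set_onto; rewrite !cardsU1 in_setU1 !(negPf (pB _)) orbF.
  by rewrite (inj_eq p_inj) ne_ij cardB; lia.
have [x02 e02] := vert 0 2 isT; have [x12 e12] := vert 1 2 isT.
have [x03 e03] := vert 0 3 isT; have [x13 e13] := vert 1 3 isT.
pose dlt x : 'rV[F]_#|johnson_vertex (4 * s) (2 * s)| := delta_mx 0 (enum_rank x).
pose I := [set p 0; p 2].
have I13 : (p 1 \notin I) && (p 3 \notin I).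
  by rewrite !in_set2 !(inj_eq p_inj).
have [I1 I3] := andP I13.
have cardI : #|I| = 2%N by rewrite cards2 (inj_eq p_inj).
have -> : mu s 2 = mu s #|I| by rewrite cardI.
(* The stable rows are those that annihilate chi_J for every proper subset J of [I]. *)
apply: (@root_char_poly_functional _ _ A (subset_col F (2 * s) I) _
  (fun v => forall J : {set 'I_(4 * s)}, J \proper I -> v *m subset_col F (2 * s) J = 0)
  (dlt x02 - dlt x12 - dlt x03 + dlt x13)).
- move=> v v0 J pJI; rewrite mul_adjacency_subset_col ?v0 ?scaler0 // => K pKJ.
  by apply: v0; apply: proper_trans pJI.
- by move=> v v0; rewrite mul_adjacency_subset_col.
- move=> J pJI; rewrite !mulmxDl !mulNmx !delta_mul_subset_col e02 e12 e03 e13.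
  have sJI := proper_sub pJI.
  have J1 : p 1 \notin J by apply: contra I1; apply: subsetP.
  have J3 : p 3 \notin J by apply: contra I3; apply: subsetP.
  (* [J] misses [p 0] or [p 2]; exchanging that point with [p 1] or [p 3], respectively, cancels the
     four terms in pairs. *)
  have [J0|J0] := boolP (p 0 \in J); last first.
    rewrite !(subset_setU1_notin _ J0) !(subset_setU1_notin _ J1).
    by rewrite subrr sub0r addNr.
  have J2 : p 2 \notin J.
    apply: contraTN pJI => J2; rewrite properE negb_and negbK orbC.
    by rewrite subUset !sub1set J0 J2.
  rewrite !(setUCA [set p 0]) !(setUCA [set p 1]).
  rewrite !(subset_setU1_notin _ J2) !(subset_setU1_notin _ J3).
  by rewrite addrAC subrK subrr.
(* Of the four vertices only [x02] contains [I], so the product is 1. *)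
- rewrite !mulmxDl !mulNmx !delta_mul_subset_col e02 e12 e03 e13.
  rewrite !(subset_setU1_notin _ I1) ![p 0 |: (p 3 |: _)]setUCA !(subset_setU1_notin _ I3).
  rewrite /I !subUset !sub1set !in_setU1 !eqxx !(inj_eq p_inj) !(negPf (pB _)) orbT /=.
  apply/eqP => /matrixP/(_ 0 0)/eqP.
  by rewrite !mxE eqxx /= !mulr1n !subr0 addr0 oner_eq0.
Qed.

(** * Degree, ordered eigenvalues and the value of lambda *)

Lemma mu2_lt_mu0 (s : nat) : (1 < s)%N -> `|mu s 2| < mu s 0.
Proof.
move=> s_gt1; have s_ge2 : 2 <= s%:R :> rat by rewrite ler_nat.
have := mu2 rat (ltnW s_gt1); rewrite -(ltr_int rat) => <-.
have m_gt0 : 0 < `|mu s 2|%:~R :> rat.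
  rewrite ltr0z normr_gt0; apply/eqP => m0.
  have := mu2 rat (ltnW s_gt1); rewrite m0 mu0 normr0 mulr0 => /esym/eqP.
  by rewrite intr_eq0 eqz_nat expn_eq0 -leqn0 leqNgt bin_gt0; lia.
by rewrite ltr_pMl //; lra.
Qed.


Lemma regular_degree_johnson_ge (s : nat) :
  ('C(2 * s, s) ^ 2 <= regular_degree (@johnson (4 * s) (2 * s) s))%N.
Proof.
have [X] : exists X : {set 'I_(4 * s)}, X \in [set X : {set 'I_(4 * s)} | #|X| == (2 * s)%N].
  by apply/set0Pn; rewrite -card_gt0 card_draws card_ord bin_gt0; lia.
rewrite inE => /eqP /vertex_set_onto[x _].
apply: leq_trans (leq_bigmax x).
have := card_johnson_nbhd x set0; rewrite /= set0I cards0 !subn0 mulnn => <-.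
by apply/subset_leq_card/subsetP => y; rewrite !inE => /andP[].
Qed.

Lemma count_flatten_nseq (T : eqType) (f : T -> nat) (s : seq T) (x : T) :
  uniq s -> (count_mem x (flatten [seq nseq (f y) y | y <- s]) <= f x)%N.
Proof.
elim: s => //= y s IHs /andP[ys us]; rewrite count_cat count_nseq /=.
have [eq_yx|_] := eqVneq y x; last by rewrite mul0n IHs.
rewrite mul1n eq_yx (_ : count_mem x _ = 0%N) ?addn0 //.
apply/count_memPn/flatten_mapP => -[z zs]; rewrite mem_nseq => /andP[_ /eqP xz].
by rewrite eq_yx xz zs in ys.
Qed.

Lemma mem_eigenvalues (R : rcfType) (m : nat) (A : 'M[R]_m) (x : R) :
  (x \in eigenvalues A) = root (char_poly A) x.
Proof.
have p_neq0 := monic_neq0 (char_poly_monic A).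
rewrite /eigenvalues mem_sort; apply/flatten_mapP/idP => [[y yr]|rx].
  rewrite mem_nseq => /andP[_ /eqP ->].
  by move: yr; rewrite -(roots_on_rootsR p_neq0) => /andP[].
exists x; first by rewrite -(roots_on_rootsR p_neq0) rx in_itv.
by rewrite mem_nseq eqxx andbT -XsubC_dvd // dvdp_XsubCl.
Qed.

Lemma count_mem_eigenvalues (R : rcfType) (m : nat) (A : 'M[R]_m) (x : R) :
  (count_mem x (eigenvalues A) <= mup x (char_poly A))%N.
Proof.
rewrite /eigenvalues count_sort; apply: count_flatten_nseq.
exact: sorted_uniq lt_trans (@ltxx _ R) _ (sorted_roots _ _ _).
Qed.

(** The least eigenvalue is -b, and since d occurs at most once, the entry of index 1 is at most
    b. *)
Lemma graph_lambda_eq (R : rcfType) (V : finType) (e : rel V) (d b : R) :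
  let p := char_poly (adjacency_matrix R e) in
  (forall x, root p x -> x = d \/ `|x| <= b) ->
  0 <= b < d -> (mup d p <= 1)%N -> root p (- b) -> graph_lambda R e = b.
Proof.
move=> p rootp /andP[b_ge0 b_lt_d] mupd; rewrite /p -mem_eigenvalues => lb.
have := leq_trans (count_mem_eigenvalues _ d) mupd.
rewrite /graph_lambda; set l := eigenvalues _ in lb *.
have {}rootp x : x \in l -> x = d \/ `|x| <= b by rewrite mem_eigenvalues => /rootp.
have sl : sorted (fun x y : R => y <= x) l.
  by apply: sort_sorted => x y; rewrite le_total.
move=> countd.
have lastE : last 0 l = - b.
  apply/eqP; rewrite eq_le; apply/andP; split.
    have gtrans : transitive (fun x y : R => y <= x).
      by move=> x y z xy yz; apply: le_trans yz xy.
    rewrite -nth_last -[X in _ <= X](nth_index 0 lb).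
    have i_lt : (index (- b)%R l < size l)%N by rewrite index_mem.
    have l_gt0 : (0 < size l)%N by apply: leq_ltn_trans i_lt.
    by apply: (sorted_leq_nth gtrans (@lexx _ R) 0 sl);
      rewrite ?inE ?ltn_predL // -ltnS prednK.
  have : last 0 l \in l by case: (l) lb => // y l' _; rewrite [last _ _]/(last y l') mem_last.
  by case/rootp => [->|]; [lra | rewrite ler_norml => /andP[]].
rewrite lastE opprK; apply/max_idPr.
(* With fewer than two entries the entry of index 1 is the default 0 <= b. *)
case: l {lb lastE} rootp sl countd => [|x [|y l]] rootp //= /andP[le_yx _].
(* If the second entry is d, the first one is at least d > b, hence also d, and d occurs twice. *)
have := rootp y; rewrite !inE eqxx orbT => /(_ isT)[yd|]; last first.
  by rewrite ler_norml => /andP[].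
have := rootp x; rewrite !inE eqxx => /(_ isT)[xd|]; first by rewrite xd yd eqxx.
by rewrite ler_norml => /andP[_ le_xb]; move: le_yx; rewrite yd; lra.
Qed.

Lemma graph_lambda_johnson (R : rcfType) (s : nat) : (1 < s)%N ->
  graph_lambda R (@johnson (4 * s) (2 * s) s) = `|mu s 2|%:~R.
Proof.
move=> s_gt1; have s_gt0 := ltnW s_gt1.
set A := adjacency_matrix R (@johnson (4 * s) (2 * s) s).
have one_col : const_mx 1 = subset_col R (2 * s) (set0 : {set 'I_(4 * s)}).
  by apply/colP => i; rewrite !mxE sub0set.
apply: (@graph_lambda_eq _ _ _ (mu s 0)%:~R).
- move=> x; rewrite -eigenvalue_root_char => /eigenvalueP[w eig w_neq0].
  have [i le_i [-> _]] := eigenvalue_mu w_neq0 eig.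
  have [->|i_gt0] := posnP i; [by left | right].
  by rewrite -intr_norm ler_int norm_mu_le ?i_gt0.
- by rewrite ler0z normr_ge0 ltr_int mu2_lt_mu0.
- apply: mup_row_sum => [|w eig w1].
    rewrite one_col adjacency_subset_col (big_pred1 set0) => [|J]; last exact: subset0.
    by rewrite -fdiff_mu cards0.
  (* A nonzero such [w] would give mu(0) = mu(i) with i > 0, against |mu(i)| <= |mu(2)| < mu(0). *)
  apply/eqP; apply: contraT => w_neq0.
  have [i le_i [eq_mu i0]] := eigenvalue_mu w_neq0 eig.
  have [/i0|i_gt0] := posnP i; first by rewrite -one_col w1 eqxx.
  have := @norm_mu_le s i s_gt1; rewrite i_gt0 le_i => /(_ isT).
  move/intr_inj: eq_mu => <-; rewrite ger0_norm ?mu0 // -mu0.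
  by rewrite leNgt mu2_lt_mu0.
(* As mu(2) <= 0, the value -|mu(2)| is the eigenvalue mu(2) itself. *)
- by rewrite ler0_norm ?mu2_le0 // rmorphN opprK; apply: root_char_poly_mu2.
Qed.

(* The closed formulas and the asymptotic bound *)
From mathcomp Require Import all_classical all_reals all_analysis.
Import Order.TTheory GRing.Theory Num.Theory.
Import numFieldNormedType.Exports.
Local Open Scope classical_set_scope.
Local Open Scope ring_scope.

Theorem theorem2p1 (R : realType) :
  (exists N : nat, forall s : nat, (N < s)%N ->
    [/\ graph_lambda R (@johnson (4 * s) (2 * s) s) = `|E s 2|%:~R,
        `|E s 2|%:~R =
          (4 * s%:R - 2) / s%:R ^+ 2 * 'C(2 * s - 2, s - 1)%:R ^+ 2 :> R
      & (4 * s%:R - 2) / s%:R ^+ 2 * 'C(2 * s - 2, s - 1)%:R ^+ 2 =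
          1 / (4 * s%:R - 2) * (E s 0)%:~R :> R]) /\
  (fun s : nat => graph_lambda R (@johnson (4 * s) (2 * s) s) : R^o) =O_\oo
  (fun s : nat =>
     ((regular_degree (@johnson (4 * s) (2 * s) s))%:R / s%:R : R) : R^o).
Proof.
split.
  exists 1%N => s s_gt1; have s_gt0 := ltnW s_gt1.
  have eq1 : `|E s 2|%:~R =
      (4 * s%:R - 2) / s%:R ^+ 2 * 'C(2 * s - 2, s - 1)%:R ^+ 2 :> R.
    by rewrite E2_mu // mu2_formula.
  split=> //; first by rewrite graph_lambda_johnson // E2_mu.
  rewrite -eq1 E2_mu // E0_mu -mu2 // mulrA div1r mulVf ?mul1r //.
  by have : 2 <= s%:R :> R; [rewrite ler_nat | move=> ?; apply/eqP; lra].
(* The constant 1 suffices: s |mu(2)| <= (4s - 2) |mu(2)| = C(2s, s)^2, which is at most the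
   degree. *)
apply/eqO_exP; exists 1 => //; near=> s.
have s_gt1 : (1 < s)%N by near: s; exact: nbhs_infty_gt.
have s_ge2 : 2 <= s%:R :> R by rewrite ler_nat.
have deg_ge0 : 0 <= (regular_degree (@johnson (4 * s) (2 * s) s))%:R :> R by [].
rewrite mul1r graph_lambda_johnson // [leRHS]ger0_norm ?divr_ge0 //.
rewrite ger0_norm ?ler0z // ler_pdivlMr; last by lra.
apply: (@le_trans _ _ (mu s 0)%:~R).
  rewrite -mu2 ?(ltnW s_gt1) // mulrC; apply: ler_wpM2r; first by rewrite ler0z.
  by lra.
by rewrite mu0 -pmulrn ler_nat regular_degree_johnson_ge.
Unshelve. all: by end_near. Qed.
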